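(* Let $D$ be a web diagram with $m\ge 1$ edges and let $W=W(D)$ be its web world. Then all row sums of the web-colouring matrix $M^{(W)}(x)$ are equal, and for every $D_1\in W$, $$\sum_{D_2\in W} M^{(W)}_{D_1,D_2}(x)\;=\;\sum_{\ell=1}^{m} x^{\ell}\,\ell!\,S(m,\ell),$$ where $S(m,\ell)$ denotes the Stirling number of the second kind (this is the ordered Bell polynomial).
   Context: A web diagram on $n$ pegs with $L$ edges is a set $D=\{e_j=(x_j,y_j,a_j,b_j):1\le j\le L\}$ of $L$ distinct 4-tuples of positive integers (edge $e_j$ joins peg $x_j$ at height $a_j$ to peg $y_j$ at height $b_j$) such that (i) $1\le x_j<y_j\le n$ for all $j$, and (ii) for each peg $i$, if $p_i(D)$ is the number of $j$ with $x_j=i$ or $y_j=i$, then $\{b_j:y_j=i\}\cup\{a_j:x_j=i\}=\{1,\dots,p_i(D)\}$. For web diagrams $D,D'$ with pegs in $\{1,\dots,n\}$, the sum is $D\oplus D'=D\cup\{(x',y',a'+p_{x'}(D),b'+p_{y'}(D)):(x',y',a',b')\in D'\}$ ($D'$ placed on top of $D$). For $X\subseteq D$, $\mathrm{rel}(X)$ is the web diagram obtained from $X$ by relabelling, on each peg, the heights of the endpoints of edges of $X$ by $1,2,\dots,\ell_i$ preserving their relative order. The web world $W(D)$ is the set of all web diagrams obtained from $D$ by permuting, independently on each peg $i$, the heights $1,\dots,p_i(D)$ of the endpoints on that peg. An $\ell$-colouring of $D$ is a surjection $c:\{1,\dots,L\}\to\{1,\dots,\ell\}$; with $D_c(t)=\{e_j:c(j)=t\}$,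 the reconstruction of $D$ according to $c$ is $\mathcal{R}(D,c)=\mathrm{rel}(D_c(1))\oplus\cdots\oplus\mathrm{rel}(D_c(\ell))\in W(D)$. For $D_1,D_2\in W$, $f(D_1,D_2,\ell)$ is the number of $\ell$-colourings $c$ of $D_1$ with $\mathcal{R}(D_1,c)=D_2$. The web-colouring matrix $M^{(W)}(x)$ is indexed by $W\times W$ with entries $M^{(W)}_{D_1,D_2}(x)=\sum_{\ell\ge1}x^\ell f(D_1,D_2,\ell)$. *)

(* Defs.v *)
From mathcomp Require Import all_boot all_order all_algebra all_fingroup.
From mathcomp Require Import finmap.
Set Implicit Arguments.
Unset Strict Implicit.
Unset Printing Implicit Defensive.
Import GRing.Theory.
Local Open Scope fset_scope.
Local Open Scope nat_scope.

(* (x, y, a, b): joins peg x at height a to peg y at height b; pegs and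
   heights are numbered from 1. *)
Notation edge := (nat * nat * nat * nat)%type.

Definition lpeg (e : edge) : nat := e.1.1.1.
Definition rpeg (e : edge) : nat := e.1.1.2.
Definition lheight (e : edge) : nat := e.1.2.
Definition rheight (e : edge) : nat := e.2.

(* p_i(D) *)
Definition npeg (D : {fset edge}) (i : nat) : nat :=
  #|` [fset e in D | (lpeg e == i) || (rpeg e == i)] |.

Definition heights (D : {fset edge}) (i : nat) : {fset nat} :=
  [fset rheight e | e in D & rpeg e == i] `|`
  [fset lheight e | e in D & lpeg e == i].

Definition web_diagram (n : nat) (D : {fset edge}) : Prop :=
  (forall e : edge, e \in D -> 1 <= lpeg e < rpeg e /\ rpeg e <= n) /\
  (forall i : nat, 1 <= i <= n ->
     forall h : nat, (h \in heights D i) = (1 <= h <= npeg D i)).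

(* Applies [s i] to the height of every endpoint on peg i. *)
Definition map_heights (s : nat -> nat -> nat) (D : {fset edge}) : {fset edge} :=
  [fset ((lpeg e, rpeg e, s (lpeg e) (lheight e), s (rpeg e) (rheight e)) : edge)
  | e in D].

(* D (+) D' *)
Definition web_sum (D D' : {fset edge}) : {fset edge} :=
  D `|` map_heights (fun i h => h + npeg D i) D'.

(* rel(X): a height is replaced by its rank among the heights of X on that peg. *)
Definition relabel (X : {fset edge}) : {fset edge} :=
  map_heights (fun i h => #|` [fset h' in heights X i | h' <= h] |) X.

(* W(D), for D on n pegs.  Peg i carries a permutation [s i] of {0, ..., #|`D|}
   moving only points of {1, ..., p_i(D)}; as p_i(D) <= #|`D| this is an
   arbitrary permutation of {1, ..., p_i(D)} (see [web_worldP]). *)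
Definition web_world (n : nat) (D : {fset edge}) : {fset {fset edge}} :=
  [fset map_heights (fun i h => val (s (inord i) (inord h))) D
  | s : {ffun 'I_n.+1 -> 'S_(#|` D|.+1)}
    in [pred s : {ffun 'I_n.+1 -> 'S_(#|` D|.+1)} |
          [forall i : 'I_n.+1,
             perm_on [set h : 'I_(#|` D|.+1) | 1 <= h <= npeg D i] (s i)]]].

(* Colourings live on the indices j of the edges e_j, in the enumeration of D;
   the colours 1, ..., l are represented by 'I_l. *)
Definition colouring (l : nat) (D : {fset edge}) : {pred {ffun 'I_#|` D| -> 'I_l}} :=
  [pred c : {ffun 'I_#|` D| -> 'I_l} | [forall t : 'I_l, exists j, c j == t]].

Definition nth_edge (D : {fset edge}) (j : 'I_#|` D|) : edge :=
  tnth (in_tuple (enum_fset D)) j.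

Definition colour_class (l : nat) (D : {fset edge})
    (c : {ffun 'I_#|` D| -> 'I_l}) (t : 'I_l) : {fset edge} :=
  [fset nth_edge j | j in [pred j : 'I_#|` D| | c j == t]].

Definition reconstruction (l : nat) (D : {fset edge})
    (c : {ffun 'I_#|` D| -> 'I_l}) : {fset edge} :=
  \big[web_sum/fset0]_(t < l) relabel (colour_class c t).

(* f(D1, D2, l) *)
Definition ncolourings (D1 D2 : {fset edge}) (l : nat) : nat :=
  #|[set c : {ffun 'I_#|` D1| -> 'I_l} |
      (c \in @colouring l D1) && (reconstruction c == D2)]|.

(* The sum over all l >= 1 is finite: see [ncolourings_gt]. *)
Definition web_colouring_matrix (W : {fset {fset edge}}) (D1 D2 : W) : {poly int} :=
  (\sum_(1 <= l < #|` val D1|.+1)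
     'X^l *+ ncolourings (val D1) (val D2) l)%R.

Definition stirling2 (m l : nat) : nat :=
  #|[set P : {set {set 'I_m}} | partition P [set: 'I_m] & #|P| == l]|.

Lemma ncolourings_gt (D1 D2 : {fset edge}) (l : nat) :
  #|` D1| < l -> ncolourings D1 D2 l = 0.
Proof.
move=> lt_l; apply/eqP; rewrite cards_eq0; apply/eqP/setP => c.
rewrite !inE; apply/negbTE/negP => /andP[/forallP csurj _].
have : #|'I_l| <= #|codom c|.
  apply/subset_leq_card/subsetP => t _.
  by have /existsP[j /eqP <-] := csurj t; apply: codom_f.
by move/leq_trans/(_ (leq_image_card _ _)); rewrite !card_ord leqNgt lt_l.
Qed.

Lemma npeg_le (D : {fset edge}) (i : nat) : npeg D i <= #|` D|.
Proof. by apply: fsubset_leq_card; apply/fsubsetP => e; rewrite !inE => /andP[]. Qed.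

Lemma web_heightP (n : nat) (D : {fset edge}) (e : edge) :
  web_diagram n D -> e \in D ->
  [/\ 1 <= lpeg e <= n, 1 <= rpeg e <= n,
      1 <= lheight e <= npeg D (lpeg e) & 1 <= rheight e <= npeg D (rpeg e)].
Proof.
move=> [h1 h2] eD; have [/andP[l1 lr] rn] := h1 _ eD.
have ln : 1 <= lpeg e <= n by rewrite l1 (leq_trans (ltnW lr)).
have rn' : 1 <= rpeg e <= n by rewrite rn andbT (leq_trans l1 (ltnW lr)).
split=> //.
  rewrite -(h2 _ ln) in_fsetU; apply/orP; right.
  by apply/imfsetP; exists e; rewrite //= inE eD eqxx.
rewrite -(h2 _ rn') in_fsetU; apply/orP; left.
by apply/imfsetP; exists e; rewrite //= inE eD eqxx.
Qed.

Lemma web_worldP (n : nat) (D D' : {fset edge}) : web_diagram n D ->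
  (D' \in web_world n D) <->
  exists s : nat -> nat -> nat,
    [/\ forall i, 1 <= i <= n ->
          {in [pred h | 1 <= h <= npeg D i] &, injective (s i)},
        forall i h, 1 <= i <= n -> 1 <= h <= npeg D i -> 1 <= s i h <= npeg D i
      & D' = map_heights s D].
Proof.
move=> wD; split.
  case/imfsetP => s /= /forallP sP ->.
  exists (fun i h => val (s (inord i) (inord h))).
  have hN i h : h <= npeg D i -> h < #|` D|.+1.
    by move=> hp; rewrite ltnS (leq_trans hp) ?npeg_le.
  split=> // [i /andP[_ iN] h h' |i h /andP[_ iN] hp].
    rewrite !inE => /andP[_ /hN hh] /andP[_ /hN hh'] /val_inj /perm_inj.
    by move/(congr1 val); rewrite /= !inordK.
  have := perm_closed (inord h) (sP (inord i)).
  by rewrite !inE !inordK ?hp // (hN i); case/andP: hp.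
case=> s [sI sS ->].
pose g (i : 'I_n.+1) (h : 'I_(#|` D|.+1)) : 'I_(#|` D|.+1) :=
  if (1 <= i <= n) && (1 <= h <= npeg D i) then inord (s i h) else h.
have gS (i : 'I_n.+1) (h : 'I_(#|` D|.+1)) : 1 <= i <= n -> 1 <= h <= npeg D i ->
    val (g i h) = s i h.
  move=> ib hb; rewrite /g ib hb /= inordK // ltnS.
  by have /andP[_ /leq_trans->] := sS _ _ ib hb => //; apply: npeg_le.
have gI i : injective (g i).
  move=> h h' E; have := congr1 val E.
  case ib : (1 <= i <= n); last by move: E; rewrite /g ib.
  case hb : (1 <= h <= npeg D i); case hb' : (1 <= h' <= npeg D i).
  - by rewrite !gS // => /sI F; apply/val_inj/F.
  - rewrite gS // /g hb' andbF => F.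
    by have := sS _ _ ib hb; rewrite F hb'.
  - rewrite [in RHS]gS // /g hb andbF => F.
    by have := sS _ _ ib hb'; rewrite -F hb.
  - by move: E; rewrite /g hb hb' andbF.
apply/imfsetP; exists [ffun i => perm (gI i)] => /=.
  apply/forallP => i; apply/subsetP => h.
  rewrite ffunE !inE permE /g; case: ifP; rewrite ?eqxx //.
  by case/andP.
apply: eq_in_imfset => // e eD; rewrite /= !ffunE !permE.
have [lb rb hl hr] := web_heightP wD eD.
have iN i : 1 <= i <= n -> nat_of_ord (inord i : 'I_n.+1) = i.
  by case/andP=> _ iN; rewrite inordK.
have hN i h : 1 <= h <= npeg D i -> nat_of_ord (inord h : 'I_(#|` D|.+1)) = h.
  by case/andP=> _ hb; rewrite inordK // ltnS (leq_trans hb) ?npeg_le.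
congr (_, _, _, _).
- by rewrite gS ?iN ?(hN _ _ hl).
- by rewrite gS ?iN ?(hN _ _ hr).
Qed.

(* Main.v *)
(** The web world of D consists of all web diagrams having the same multiset of
    peg pairs (x, y) as D. Relabelling keeps this multiset and the sum of web
    diagrams adds multisets, so the reconstruction of D1 in W(D) along any
    colouring lies in W(D). The coefficient of x^l in a row sum is therefore the
    number of all surjections from the m edges onto l colours, and a surjection
    is a set partition into l blocks together with a labelling of the blocks. *)

Require Import Defs.
From mathcomp Require Import all_boot all_order all_algebra all_fingroup.
From mathcomp Require Import finmap.
Set Implicit Arguments.
Unset Strict Implicit.
Unset Printing Implicit Defensive.
Import GRing.Theory.
Local Open Scope fset_scope.
Local Open Scope ring_scope.

(** * Surjections and set partitions *)

Definition fibre_map (m l : nat) (c : {ffun 'I_m -> 'I_l}) :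
    {ffun 'I_l -> {set 'I_m}} := [ffun t => [set j | c j == t]].

Lemma fibre_map_inj (m l : nat) : injective (@fibre_map m l).
Proof.
move=> c c' /ffunP E; apply/ffunP => j.
have /setP/(_ j) := E (c j).
by rewrite !ffunE !inE eqxx => /esym/eqP.
Qed.

(* Reading a surjection through its fibres identifies it with an injective
   labelling by 'I_l of the blocks of a partition. *)
Lemma fibre_map_surj (m l : nat) :
  [set fibre_map c | c in [set c : {ffun 'I_m -> 'I_l} |
     [forall t, exists j, c j == t]]] =
  [set f : {ffun 'I_l -> {set 'I_m}} |
     injectiveb f && partition [set f t | t : 'I_l] [set: 'I_m]].
Proof.
apply/setP => f; rewrite [in RHS]inE; apply/imsetP/andP.
- case=> c; rewrite inE => /forallP csurj ->; split.
    apply/injectiveP => t t'; rewrite !ffunE => /setP E.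
    have /existsP[j cj] := csurj t; have := E j.
    by rewrite !inE cj => /esym/eqP <-; apply/esym/eqP.
  apply/and3P; split.
  + rewrite eqEsubset subsetT; apply/subsetP => j _.
    apply/bigcupP; exists (fibre_map c (c j)); first exact: imset_f.
    by rewrite ffunE inE.
  + apply/trivIsetP => A B /imsetP[t _ ->] /imsetP[t' _ ->] neq.
    apply/pred0P => j; rewrite /= !ffunE !inE; apply/negbTE/negP.
    by case/andP => /eqP E /eqP E'; move: neq; rewrite -E -E' eqxx.
  + apply/negP => /imsetP[t _ /setP E].
    have /existsP[j cj] := csurj t; have := E j.
    by rewrite ffunE !inE cj.
- case=> /injectiveP finj /and3P[/eqP fcov /trivIsetP ftriv f0].
  have ex j : exists t, j \in f t.
    have : j \in cover [set f t | t : 'I_l] by rewrite fcov inE.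
    by case/bigcupP => A /imsetP[t _ ->] jt; exists t.
  have [c cP] := fin_all_exists ex.
  (* An index [j] in both [f (c j)] and [f t] forces [c j = t]: distinct blocks are disjoint, and
     [f] is injective. *)
  have cE j t : (c j == t) = (j \in f t).
    apply/eqP/idP => [<- //|jt]; apply/eqP/negPn/negP => neq.
    have fin u : f u \in [set f t | t : 'I_l] by apply: imset_f.
    have /pred0P/(_ j) := ftriv _ _ (fin (c j)) (fin t) (contra_neq (@finj _ _) neq).
    by rewrite /= cP jt.
  exists [ffun j => c j].
    rewrite inE; apply/forallP => t; apply/existsP.
    have [j jt] : exists j, j \in f t.
      apply/set0Pn/negP => /eqP ft; move/negP: f0; apply.
      by rewrite -ft; apply: imset_f.
    by exists j; rewrite ffunE cE.
  by apply/ffunP => t; apply/setP => j; rewrite ffunE inE ffunE cE.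
Qed.

(** Fibre maps are counted according to the partition [P] they label. Once [P] with [l] blocks is
    fixed, they are exactly the injections of ['I_l] into [P], of which there are [l!]. *)
Lemma card_surjections (m l : nat) :
  #|[set c : {ffun 'I_m -> 'I_l} | [forall t, exists j, c j == t]]| =
  (l`! * stirling2 m l)%N.
Proof.
rewrite -(card_imset _ (@fibre_map_inj m l)) fibre_map_surj -sum1_card.
pose Q := [pred P : {set {set 'I_m}} | partition P [set: 'I_m] & #|P| == l].
rewrite (partition_big (fun f : {ffun 'I_l -> {set 'I_m}} =>
  [set f t | t : 'I_l]) Q) /=; last first.
  move=> f; rewrite inE => /andP[/injectiveP finj ->] /=.
  by rewrite card_imset // card_ord.
rewrite (eq_bigr (fun=> l`!)).
  by rewrite sum_nat_const mulnC; congr (_ * _)%N; apply: eq_card => P; rewrite !inE.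
move=> P /andP[partP /eqP cardP].
(* As a falling factorial, [l!] matches the count of injective functions with values in [P]. *)
have -> : l`! = #|P| ^_ #|'I_l| by rewrite card_ord cardP ffactnn.
rewrite sum1_card -(card_inj_ffuns_on 'I_l (mem P)); apply: eq_card => f.
rewrite unfold_in [RHS]inE [X in X && _ = _]inE; apply/andP/andP.
- case=> /andP[finj _] /eqP <-; split=> //.
  by apply/ffun_onP => t; apply: imset_f.
- case=> /ffun_onP fP finj.
  (* An injection from [l] labels into [l] blocks uses every block. *)
  suff -> : [set f t | t : 'I_l] = P by rewrite finj partP eqxx.
  apply/eqP; rewrite eqEcard card_imset ?card_ord ?cardP ?leqnn ?andbT //.
    by apply/subsetP => _ /imsetP[t _ ->].
  exact/injectiveP.
Qed.

(** * Peg pairs and endpoint heights of edges *)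

Definition pegs (e : edge) : nat * nat := (lpeg e, rpeg e).

(** A predicate on peg pairs instead of edges, so that [npeg] becomes a count over [peg_pairs]. *)
Definition on_peg (i : nat) (p : nat * nat) : bool := (p.1 == i) || (p.2 == i).

Definition peg_pairs (D : {fset edge}) : seq (nat * nat) :=
  [seq pegs e | e <- enum_fset D].

(** Meaningful only when [e] meets peg [i]; otherwise the value is the arbitrary [rheight e]. *)
Definition height_at (i : nat) (e : edge) : nat :=
  if lpeg e == i then lheight e else rheight e.

Definition pegs_in (n : nat) (X : {fset edge}) : Prop :=
  forall e, e \in X -> (1 <= lpeg e < rpeg e /\ rpeg e <= n)%N.

(** The part of being a web diagram that passes to subsets, hence to colour classes: no two edges
    share an endpoint. *)
Definition separated (X : {fset edge}) : Prop :=
  forall i, {in [fset e in X | on_peg i (pegs e)] &, injective (height_at i)}.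

Definition move_heights (s : nat -> nat -> nat) (e : edge) : edge :=
  (lpeg e, rpeg e, s (lpeg e) (lheight e), s (rpeg e) (rheight e)).

Lemma map_heightsE s X : map_heights s X = [fset move_heights s e | e in X].
Proof. by []. Qed.

Lemma pegs_move s e : pegs (move_heights s e) = pegs e.
Proof. by []. Qed.

Lemma height_at_move s i e : on_peg i (pegs e) ->
  height_at i (move_heights s e) = s i (height_at i e).
Proof.
rewrite /on_peg /height_at /= -[lpeg (move_heights s e)]/(lpeg e).
by case: eqP => [<- //|_] /eqP <-.
Qed.

Lemma edge_eq e e' : pegs e = pegs e' ->
  height_at (lpeg e) e = height_at (lpeg e) e' ->
  height_at (rpeg e) e = height_at (rpeg e) e' -> (lpeg e < rpeg e)%N -> e = e'.
Proof.
case: e => [[[x y] a] b]; case: e' => [[[x' y'] a'] b'].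
rewrite /pegs /height_at /lpeg /rpeg /lheight /rheight /= => -[<- <-].
by rewrite !eqxx => -> + /ltn_eqF ltE; rewrite ltE => ->.
Qed.

Lemma npeg_count D i : npeg D i = count (on_peg i) (peg_pairs D).
Proof.
rewrite /npeg count_map -size_filter; apply: perm_size; apply: uniq_perm.
- exact: fset_uniq.
- by apply: filter_uniq; apply: fset_uniq.
- by move=> e; rewrite !inE mem_filter andbC.
Qed.

Lemma heightsE n X i : pegs_in n X ->
  heights X i = [fset height_at i e | e in [fset e in X | on_peg i (pegs e)]].
Proof.
move=> pX; apply/fsetP => h; rewrite in_fsetU; apply/orP/imfsetP.
- case=> /imfsetP[e /= ]; rewrite !inE => /andP[eX /eqP Ei] ->; exists e => //.
  + by rewrite !inE eX /on_peg /= Ei eqxx orbT.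
  + have [/andP[_ lt] _] := pX _ eX.
    by rewrite /height_at -Ei (ltn_eqF lt).
  + by rewrite !inE eX /on_peg /= Ei eqxx.
  + by rewrite /height_at Ei eqxx.
- case=> e /=; rewrite !inE /on_peg /height_at /= => /andP[eX].
  case: eqP => [Ei _ ->|_ /= Ei ->]; [right|left]; apply/imfsetP; exists e => //=.
    by rewrite !inE eX Ei eqxx.
  by rewrite !inE eX.
Qed.

Lemma npeg_out n X i : pegs_in n X -> ~~ (1 <= i <= n)%N -> npeg X i = 0%N.
Proof.
move=> pX iN; apply/eqP; rewrite cardfs_eq0; apply/eqP/fsetP => e.
rewrite !inE; apply/negbTE/negP => /andP[/pX[/andP[l1 lr] rn]].
case/orP => /eqP Ei; move: iN; rewrite -Ei ?l1 ?rn ?andbT /= ?negbK.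
  by rewrite (leq_trans (ltnW lr)).
by rewrite (leq_trans l1 (ltnW lr)).
Qed.

Lemma heights_card n X i : pegs_in n X -> separated X ->
  #|` heights X i| = npeg X i.
Proof. by move=> pX sX; rewrite (heightsE i pX) card_in_imfset //; apply: sX. Qed.

(** * Web diagrams through their height sets *)

Definition interval (k : nat) : {fset nat} := [fset h in iota 1 k].

Lemma in_interval k h : (h \in interval k) = (1 <= h <= k)%N.
Proof. by rewrite !inE mem_iota add1n ltnS. Qed.

Lemma card_interval k : #|` interval k| = k.
Proof.
rewrite -[RHS](size_iota 1 k); apply/perm_size/uniq_perm.
- exact: fset_uniq.
- exact: iota_uniq.
- by move=> h; rewrite !inE.
Qed.

(** Frees the height condition from the range of [i]: on a peg outside [1..n] both sides are
    empty. *)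
Lemma web_diagramP n D : web_diagram n D <->
  pegs_in n D /\ (forall i, heights D i = interval (npeg D i)).
Proof.
split=> [[pD hD]|[pD hD]]; split=> // i; last first.
  by move=> iN h; rewrite hD in_interval.
case iN: (1 <= i <= n)%N.
  by apply/fsetP => h; rewrite hD // in_interval.
have n0 := npeg_out pD (negbT iN).
apply/eqP; rewrite n0 eqEfcard (heightsE i pD) card_interval leq0n andbT.
apply/fsubsetP => h /imfsetP[e /= eD _].
by move/eqP: n0; rewrite cardfs_eq0 => /eqP/fsetP/(_ e); rewrite eD inE.
Qed.

(** If distinct [x] and [y] had the same image, deleting [x] would leave the image unchanged, so the
    image would have fewer elements than [A]. *)
Lemma imfset_card_inj (K K' : choiceType) (f : K -> K') (A : {fset K}) :
  #|` [fset f x | x in A]| = #|` A| -> {in A &, injective f}.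
Proof.
move=> cardE x y xA yA fxy; apply/eqP/negPn/negP => neq.
suff : (#|` [fset f x | x in A]| <= #|` A `\ x|)%N.
  by rewrite cardE (cardfsD1 x A) xA ltnn.
suff -> : [fset f x | x in A] = [fset f z | z in A `\ x].
  exact: leq_imfset_card.
apply/fsetP => z; apply/imfsetP/imfsetP => -[w /= wA ->]; last first.
  by exists w => //; move: wA; rewrite !inE => /andP[].
have [->|wx] := eqVneq w x; last by exists w; rewrite //= !inE wx.
by exists y; rewrite //= !inE eq_sym neq.
Qed.

(** Peg [i] carries [npeg D i] edges and equally many distinct heights, so no height is used
    twice. *)
Lemma web_separated n D : web_diagram n D -> separated D.
Proof.
case/web_diagramP => pD hD i; apply: imfset_card_inj.
by rewrite -(heightsE i pD) hD card_interval.
Qed.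

Lemma separatedS (X Y : {fset edge}) : X `<=` Y -> separated Y -> separated X.
Proof.
move=> /fsubsetP XY sY i e e'; rewrite !inE => /andP[/XY eY oe] /andP[/XY eY' oe'].
by apply: (sY i); rewrite !inE ?eY ?eY' /=.
Qed.

(** * Effect of moving heights *)

Lemma pegs_in_map n s X : pegs_in n X -> pegs_in n (map_heights s X).
Proof. by move=> pX _ /imfsetP[e /= /pX ? ->]. Qed.

Lemma heights_map n s X i : pegs_in n X ->
  heights (map_heights s X) i = [fset s i h | h in heights X i].
Proof.
move=> pX; have pX' : pegs_in n (map_heights s X) by apply: pegs_in_map.
rewrite (heightsE i pX) (heightsE i pX'); apply/fsetP => h.
apply/imfsetP/imfsetP => /= -[x].
- rewrite !inE => /andP[/imfsetP[e /= eX ->]] oe ->.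
  exists (height_at i e); last exact: height_at_move.
  by apply/imfsetP; exists e; rewrite //= !inE eX.
- case/imfsetP => e /=; rewrite !inE => /andP[eX oe] -> ->.
  exists (move_heights s e); last by rewrite height_at_move.
  by rewrite !inE oe andbT; apply: in_imfset.
Qed.

Lemma height_in n X e i : pegs_in n X -> e \in X -> on_peg i (pegs e) ->
  height_at i e \in heights X i.
Proof.
by move=> pX eX oe; rewrite (heightsE i pX); apply: in_imfset; rewrite /= !inE eX.
Qed.

Lemma on_lpeg e : on_peg (lpeg e) (pegs e).
Proof. by rewrite /on_peg eqxx. Qed.

Lemma on_rpeg e : on_peg (rpeg e) (pegs e).
Proof. by rewrite /on_peg eqxx orbT. Qed.

(** Moving heights keeps the pegs of each edge, so a multiplicity could only be lost by merging two
    edges; injectivity of each [s i] on the heights in use excludes this. *)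
Lemma peg_pairs_map n s X : pegs_in n X ->
  (forall i, {in heights X i &, injective (s i)}) ->
  perm_eq (peg_pairs (map_heights s X)) (peg_pairs X).
Proof.
move=> pX sI.
have inj : {in X &, injective (move_heights s)}.
  move=> e e' eX eX' E.
  have Ep : pegs e = pegs e' by rewrite -(pegs_move s e) E.
  have Eh i : on_peg i (pegs e) -> height_at i e = height_at i e'.
    move=> oe; have oe' : on_peg i (pegs e') by rewrite -Ep.
    by apply: (sI i); rewrite ?(height_in pX) // -!height_at_move ?E.
  have [/andP[_ lt] _] := pX _ eX.
  by apply: edge_eq => //; apply: Eh; rewrite ?on_lpeg ?on_rpeg.
rewrite /peg_pairs map_heightsE.
apply: (perm_trans (perm_map pegs (enum_imfset _ _))); first exact: inj.
by rewrite -map_comp.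
Qed.

Lemma heightsP n X i h : pegs_in n X ->
  reflect (exists e, [/\ e \in X, on_peg i (pegs e) & h = height_at i e])
          (h \in heights X i).
Proof.
move=> pX; rewrite (heightsE i pX); apply: (iffP (imfsetP _ _ _ _)) => /=.
  by case=> e; rewrite !inE => /andP[eX oe] ->; exists e.
by case=> e [eX oe ->]; exists e; rewrite // !inE eX.
Qed.

(** * Unions and sums of diagrams *)

Lemma pegs_inU n X Y : pegs_in n X -> pegs_in n Y -> pegs_in n (X `|` Y).
Proof. by move=> pX pY e; rewrite in_fsetU => /orP[/pX|/pY]. Qed.

Lemma heightsU n X Y i : pegs_in n X -> pegs_in n Y ->
  heights (X `|` Y) i = heights X i `|` heights Y i.
Proof.
move=> pX pY; have pXY := pegs_inU pX pY.
apply/fsetP => h; rewrite in_fsetU; apply/(heightsP _ _ pXY)/orP.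
- case=> e [+ oe ->]; rewrite in_fsetU => /orP[] eX; [left|right].
    exact: (height_in pX).
  exact: (height_in pY).
- case=> [/(heightsP _ _ pX)|/(heightsP _ _ pY)] [e [eX oe ->]];
  by exists e; rewrite in_fsetU eX ?orbT.
Qed.

Lemma peg_pairsU X Y : [disjoint X & Y] ->
  perm_eq (peg_pairs (X `|` Y)) (peg_pairs X ++ peg_pairs Y).
Proof.
move=> dXY; rewrite /peg_pairs -map_cat; apply/perm_map/uniq_perm.
- exact: fset_uniq.
- rewrite cat_uniq !fset_uniq /= andbT; apply/hasPn => e eY.
  by apply: contraL eY => eX; apply: (fdisjointP dXY).
- by move=> e; rewrite in_fsetU mem_cat.
Qed.

Lemma perm_npeg X Y i : perm_eq (peg_pairs X) (peg_pairs Y) -> npeg X i = npeg Y i.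
Proof. by move=> /seq.permP E; rewrite !npeg_count. Qed.

(** On each peg the edges of [A] end at height at most [npeg A i], the shifted edges of [B] strictly
    above it. *)
Lemma web_sum_disjoint n A B : web_diagram n A -> web_diagram n B ->
  [disjoint A & map_heights (fun i h => h + npeg A i)%N B].
Proof.
move=> /web_diagramP[pA hA] /web_diagramP[pB hB].
apply/fdisjointP => e eA; apply/negP => /imfsetP[e' /= eB Ee].
have := height_in pA eA (on_lpeg e).
rewrite hA in_interval => /andP[_].
have oe' : on_peg (lpeg e) (pegs e') by rewrite Ee on_lpeg.
have := height_in pB eB oe'; rewrite hB in_interval => /andP[h1 _].
rewrite {2}Ee (@height_at_move (fun i h => h + npeg A i)%N _ _ oe').
by rewrite -{2}[npeg A _]add0n leq_add2r leqNgt h1.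
Qed.

Lemma peg_pairs_sum n A B : web_diagram n A -> web_diagram n B ->
  perm_eq (peg_pairs (web_sum A B)) (peg_pairs A ++ peg_pairs B).
Proof.
move=> wA wB; apply: (perm_trans (peg_pairsU (web_sum_disjoint wA wB))).
have [pB _] := wB.
by rewrite perm_cat2l; apply: (peg_pairs_map pB) => i h h' _ _ /addIn.
Qed.

Lemma web_sum_web n A B : web_diagram n A -> web_diagram n B ->
  web_diagram n (web_sum A B).
Proof.
move=> wA wB; have [pA hA] := (web_diagramP n A).1 wA.
have [pB hB] := (web_diagramP n B).1 wB.
have pB' := @pegs_in_map n (fun i h => h + npeg A i)%N B pB.
apply/web_diagramP; split=> [|i]; first exact: pegs_inU.
rewrite [npeg (web_sum A B) i]npeg_count (seq.permP (peg_pairs_sum wA wB)) count_cat.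
rewrite -!npeg_count (heightsU i pA pB') (heights_map _ _ pB) hA hB.
apply/fsetP => h; rewrite in_fsetU !in_interval; apply/orP/andP.
- case=> [/andP[-> le]|/imfsetP[k /=]]; first by rewrite (leq_trans le) ?leq_addr.
  rewrite in_interval => /andP[k1 k2] ->.
  by rewrite addnC leq_add2l addn_gt0 k1 orbT.
(* Heights up to [npeg A i] come from [A]; a larger [h] is the shift of the height [h - npeg A i] of
   [B]. *)
- case=> h1 h2; case: (leqP h (npeg A i)) => hA'; first by left; rewrite h1.
  right; apply/imfsetP; exists (h - npeg A i)%N; last by rewrite subnK // ltnW.
  by rewrite /= in_interval subn_gt0 hA' leq_subLR.
Qed.

(** * Ranks and relabelling *)

Lemma rank_inj (H : {fset nat}) :
  {in H &, injective (fun h => #|` [fset h' in H | (h' <= h)%N]|)}.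
Proof.
(* The rank is strictly increasing on [H]: passing from [h] to [h'] adds at least [h'] itself to the
   counted set. *)
suff mono h h' : h \in H -> h' \in H -> (h < h')%N ->
    (#|` [fset k in H | (k <= h)%N]| < #|` [fset k in H | (k <= h')%N]|)%N.
  move=> h h' hH hH' /= E; case: (ltngtP h h') => // lt.
    by have := mono _ _ hH hH' lt; rewrite E ltnn.
  by have := mono _ _ hH' hH lt; rewrite E ltnn.
move=> hH hH' lt; apply: fproper_ltn_card; rewrite fproperEneq.
apply/andP; split; last first.
  apply/fsubsetP => k; rewrite !inE => /andP[-> /= kh].
  exact: leq_trans kh (ltnW lt).
by apply/eqP => /fsetP/(_ h'); rewrite !inE hH' /= leqnn leqNgt lt.
Qed.

(** The ranks are distinct and lie between 1 and the size of [H], so by counting they exhaust that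
    interval. *)
Lemma rank_image (H : {fset nat}) :
  [fset #|` [fset h' in H | (h' <= h)%N]| | h in H] = interval #|` H|.
Proof.
apply/eqP; rewrite eqEfcard card_interval card_in_imfset ?leqnn ?andbT; last exact: rank_inj.
 apply/fsubsetP => _ /imfsetP[h /= hH ->]; rewrite in_interval.
rewrite cardfs_gt0; apply/andP; split.
  by apply/fset0Pn; exists h; rewrite !inE hH leqnn.
by apply: fsubset_leq_card; apply/fsubsetP => k; rewrite !inE => /andP[].
Qed.

Lemma peg_pairs_relabel n X : pegs_in n X ->
  perm_eq (peg_pairs (relabel X)) (peg_pairs X).
Proof. by move=> pX; apply: (peg_pairs_map pX) => i; apply: rank_inj. Qed.

Lemma relabel_web n X : pegs_in n X -> separated X -> web_diagram n (relabel X).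
Proof.
move=> pX sX; apply/web_diagramP; split=> [|i]; first exact: pegs_in_map.
rewrite (heights_map _ _ pX) rank_image (heights_card i pX sX).
by rewrite (perm_npeg i (peg_pairs_relabel pX)).
Qed.

(** * Colour classes and reconstructions *)

Lemma colour_classS l (D : {fset edge}) (c : {ffun 'I_#|` D| -> 'I_l}) t :
  colour_class c t `<=` D.
Proof. by apply/fsubsetP => _ /imfsetP[j _ ->]; apply: mem_tnth. Qed.

Lemma nth_edge_inj (D : {fset edge}) : injective (@nth_edge D).
Proof. by apply/tuple_uniqP; apply: fset_uniq. Qed.

Lemma web_fset0 n : web_diagram n fset0.
Proof.
have p0 : pegs_in n fset0 by move=> e; rewrite inE.
have n0 i : npeg fset0 i = 0%N.
  by apply/eqP; rewrite -leqn0; apply: (leq_trans (npeg_le _ _)); rewrite cardfs0.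
apply/web_diagramP; split=> // i; apply/fsetP => h; rewrite n0 in_interval.
apply/(heightsP _ _ p0)/idP => [[e []]|]; first by rewrite inE.
by case: h.
Qed.

Lemma peg_pairs0 : peg_pairs fset0 = [::].
Proof. by apply: size0nil; rewrite size_map cardfs0. Qed.

(** The two conclusions are proved in one induction: peg pairs add up only because each partial sum
    is again a web diagram. *)
Lemma web_big_sum n (I : Type) (r : seq I) (X : I -> {fset edge}) :
  (forall t, web_diagram n (X t)) ->
  web_diagram n (\big[web_sum/fset0]_(t <- r) X t) /\
  (forall a, count a (peg_pairs (\big[web_sum/fset0]_(t <- r) X t)) =
             (\sum_(t <- r) count a (peg_pairs (X t)))%N).
Proof.
move=> wX; elim: r => [|t r [wr cr]].
  rewrite big_nil; split=> [|a]; first exact: web_fset0.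
  by rewrite big_nil peg_pairs0.
rewrite big_cons; split=> [|a]; first exact: web_sum_web.
by rewrite big_cons (seq.permP (peg_pairs_sum (wX t) wr)) count_cat cr.
Qed.

Lemma count_colour_class l (D : {fset edge}) (c : {ffun 'I_#|` D| -> 'I_l}) t a :
  count a (peg_pairs (colour_class c t)) =
  (\sum_(j | c j == t) a (pegs (nth_edge j)))%N.
Proof.
rewrite (seq.permP (perm_map pegs (enum_imfset _ _))); last first.
  by move=> j j' _ _; apply: nth_edge_inj.
rewrite -map_comp -sumn_count sumnE !big_map /=.
by rewrite big_enum.
Qed.

Lemma count_peg_pairs (D : {fset edge}) a :
  count a (peg_pairs D) = (\sum_(j < #|` D|) a (pegs (nth_edge j)))%N.
Proof. by rewrite -sumn_count sumnE !big_map big_tnth. Qed.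

(** The colour classes split the edge indices of [D], and neither relabelling nor summing changes
    the total count of any kind of peg pair. *)
Lemma reconstruction_web n l (D : {fset edge}) (c : {ffun 'I_#|` D| -> 'I_l}) :
  web_diagram n D ->
  web_diagram n (reconstruction c) /\
  perm_eq (peg_pairs (reconstruction c)) (peg_pairs D).
Proof.
move=> wD; have [pD _] := wD; have sD := web_separated wD.
have pX t : pegs_in n (colour_class c t).
  by move=> e /(fsubsetP (colour_classS c t))/pD.
have wX t : web_diagram n (relabel (colour_class c t)).
  by apply: relabel_web => //; apply: separatedS sD; apply: colour_classS.
have [wR cR] := web_big_sum (index_enum 'I_l) wX; split=> //.
apply/seq.permP => a; rewrite cR count_peg_pairs.
rewrite (partition_big c predT) //=; apply: eq_bigr => t _.
by rewrite (seq.permP (peg_pairs_relabel (pX t))) count_colour_class.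
Qed.

(** * The web world as a class of diagrams with equal peg pairs *)

Lemma web_world_web n D D' : web_diagram n D -> D' \in web_world n D ->
  web_diagram n D' /\ perm_eq (peg_pairs D') (peg_pairs D).
Proof.
move=> wD /(web_worldP _ wD)[s [sI sS ->]].
have [pD hD] := (web_diagramP n D).1 wD.
(* The properties of [s] are available only for pegs in [1..n]; a peg that carries a height is one
   of them. *)
have hP i h : h \in heights D i -> (1 <= i <= n)%N && (1 <= h <= npeg D i)%N.
  move=> hi; have := hi; rewrite hD in_interval => hb; rewrite hb andbT.
  apply/negPn/negP => iN; move: hb; rewrite (npeg_out pD iN).
  by case: h {hi}.
have sI' i : {in heights D i &, injective (s i)}.
  by move=> h h' /hP/andP[iN hb] /hP/andP[_ hb']; apply: (sI i).
have pp := peg_pairs_map pD sI'; split=> //.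
apply/web_diagramP; split=> [|i]; first exact: pegs_in_map.
rewrite (heights_map _ _ pD) (perm_npeg i pp).
(* [s i] maps the [npeg D i] heights injectively into an interval of the same size, hence onto
   it. *)
apply/eqP; rewrite eqEfcard card_interval card_in_imfset; last exact: sI'.
rewrite /= [X in (_ <= X)%N](_ : _ = npeg D i); last first.
  by rewrite -[RHS]card_interval -hD.
rewrite leqnn andbT.
apply/fsubsetP => _ /imfsetP[h /= /hP/andP[iN hb] ->].
by rewrite in_interval; apply: sS.
Qed.

(** The permutation of the images is read as a list of indices into [t], and the same indices are
    used to rearrange [t] itself. The case of empty [t] is split off because [nth] needs a
    default. *)
Lemma perm_map_lift (T T' : eqType) (f : T -> T') (s t : seq T) :
  perm_eq (map f s) (map f t) ->
  exists2 u, perm_eq u t & map f u = map f s.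
Proof.
case: t => [|x t]; first by move/perm_nilP => E; exists [::]; rewrite ?E.
case/(perm_iotaP (f x)) => Is; rewrite size_map => pIs E.
exists [seq nth x (x :: t) i | i <- Is].
  by apply/(perm_iotaP x); exists Is.
rewrite E -map_comp; apply/eq_in_map => i.
rewrite (perm_mem pIs) mem_iota add0n => /andP[_ lt].
exact: esym (nth_map x (f x) f lt).
Qed.

(* The web world consists of the web diagrams with the prescribed multiset of
   peg pairs: matching edges with equal peg pairs moves the endpoints on each
   peg by a permutation of the heights. *)
Lemma web_world_perm n D D' : web_diagram n D -> web_diagram n D' ->
  perm_eq (peg_pairs D) (peg_pairs D') -> D' \in web_world n D.
Proof.
move=> wD wD' pp; apply/(web_worldP _ wD).
have [pD hD] := (web_diagramP n D).1 wD.
have [pD' hD'] := (web_diagramP n D').1 wD'.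
have sD := web_separated wD; have sD' := web_separated wD'.
have [u puD' Eu] := perm_map_lift pp.
pose e0 : edge := (0, 0, 0, 0)%N.
have szu : size u = #|` D| by rewrite -(size_map pegs u) Eu size_map.
(* [u] lists the edges of [D'] so that its peg pairs agree with those of [D] position by position;
   [phi] matches equal positions. The default [e0] is never reached for [e] in [D]. *)
pose phi e := nth e0 u (index e D).
have phi_in e : e \in D -> phi e \in D'.
  move=> eD; rewrite -[_ \in D'](perm_mem puD') mem_nth // szu.
  by rewrite index_mem.
have phi_pegs e : e \in D -> pegs (phi e) = pegs e.
  move=> eD; rewrite -(nth_map e0 (0, 0)%N) ?szu ?index_mem // Eu.
  by rewrite (nth_map e0) ?index_mem // nth_index.
have phi_inj : {in D &, injective phi}.
  move=> e e' eD eD' /eqP; rewrite nth_uniq ?szu ?index_mem //.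
    by move/eqP/(congr1 (nth e0 D)); rewrite !nth_index.
  by rewrite (perm_uniq puD') fset_uniq.
pose at_ i h e := on_peg i (pegs e) && (height_at i e == h).
pose s i h := height_at i (phi (nth e0 D (find (at_ i h) D))).
have sE i e : e \in D -> on_peg i (pegs e) -> s i (height_at i e) = height_at i (phi e).
  move=> eD oe; have hs : has (at_ i (height_at i e)) D.
    by apply/hasP; exists e; rewrite // /at_ oe eqxx.
  rewrite /s; congr (height_at i (phi _)).
  have /andP[oe' /eqP Eh] := nth_find e0 hs.
  by apply: (sD i) Eh; rewrite !inE ?eD ?oe ?oe' // mem_nth // -has_find.
have hP i h : (1 <= h <= npeg D i)%N ->
    exists e, [/\ e \in D, on_peg i (pegs e) & h = height_at i e].
  by rewrite -in_interval -hD => /(heightsP _ _ pD).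
exists s; split.
- move=> i iN h h'; rewrite !inE => /hP[e [eD oe ->]] /hP[e' [eD' oe' ->]].
  rewrite !sE // => E; congr height_at; apply: phi_inj => //.
  by apply: (sD' i) E; rewrite !inE phi_in ?phi_pegs.
- move=> i h iN /hP[e [eD oe ->]]; rewrite sE // (perm_npeg i pp).
  by rewrite -in_interval -hD'; apply: (height_in pD'); rewrite ?phi_in ?phi_pegs.
- have mE e : e \in D -> move_heights s e = phi e.
    move=> eD; have [/andP[_ lt] _] := pD _ eD.
    apply: edge_eq => //; rewrite ?pegs_move ?phi_pegs //.
      by rewrite height_at_move ?on_lpeg // sE // on_lpeg.
    by rewrite height_at_move ?on_rpeg // sE // on_rpeg.
  (* The moved diagram lies in [D'] and, [phi] being injective, has as many edges. *)
  apply/esym/eqP; rewrite eqEfcard map_heightsE; apply/andP; split.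
    by apply/fsubsetP => _ /imfsetP[e /= eD ->]; rewrite mE // phi_in.
  rewrite card_in_imfset => [|e e' eD eD']; last by rewrite !mE //; apply: phi_inj.
  by rewrite /= -(perm_size puD') szu.
Qed.

(** * Row sums *)

Lemma reconstruction_in_world n l (D D1 : {fset edge})
    (c : {ffun 'I_#|` D1| -> 'I_l}) :
  web_diagram n D -> D1 \in web_world n D -> reconstruction c \in web_world n D.
Proof.
move=> wD /(web_world_web wD)[wD1 pp].
have [wR ppR] := reconstruction_web c wD1.
by apply: web_world_perm => //; rewrite perm_sym; apply: perm_trans pp.
Qed.

Lemma card_web_world n (D D1 : {fset edge}) :
  web_diagram n D -> D1 \in web_world n D -> #|` D1| = #|` D|.
Proof.
by move=> wD /(web_world_web wD)[_ /perm_size]; rewrite !size_map.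
Qed.

(** After exchanging the sums, each colouring contributes exactly once, at the single [D2] equal to
    its reconstruction; that this [D2] belongs to the web world is the essential point. *)
Lemma sum_ncolourings n (D : {fset edge}) (D1 : web_world n D) l :
  web_diagram n D ->
  (\sum_(D2 : web_world n D) ncolourings (val D1) (val D2) l)%N =
  #|[set c in @colouring l (val D1)]|.
Proof.
move=> wD; under eq_bigr => D2 _ do rewrite /ncolourings -sum1_card.
under eq_bigr => D2 _ do under eq_bigl => c do rewrite inE.
rewrite (exchange_big_dep (fun c => c \in @colouring l (val D1))) /=; last first.
  by move=> D2 c _ /andP[].
rewrite -sum1_card; under [RHS]eq_bigl => c do rewrite inE.
apply: eq_bigr => c cc.
have RW := reconstruction_in_world c wD (valP D1).
rewrite (big_pred1 [` RW]) // => D2.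
by rewrite cc /= -val_eqE eq_sym.
Qed.

(** The range of [l] depends on [D1] alone, so the sums can be exchanged; as [D1] has as many edges
    as [D], the outcome is the same for every row. *)
Lemma row_sum n (D : {fset edge}) (D1 : web_world n D) : web_diagram n D ->
  \sum_(D2 : web_world n D) web_colouring_matrix D1 D2 =
  \sum_(1 <= l < #|` D|.+1) 'X^l *+ (l`! * stirling2 #|` D| l).
Proof.
move=> wD; rewrite exchange_big /= (card_web_world wD (valP D1)).
apply: eq_bigr => l _; rewrite sumrMnr (sum_ncolourings D1 l wD).
congr (_ *+ _); rewrite -(card_web_world wD (valP D1)) -card_surjections.
by apply: eq_card => c; rewrite !inE.
Qed.

Theorem theorem2p14 (n m : nat) (D : {fset edge}) (webD : web_diagram n D)
    (sizeD : #|` D| = m) (m_ge1 : (1 <= m)%N) :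
  (forall D1 D1' : web_world n D,
     \sum_(D2 : web_world n D) web_colouring_matrix D1 D2 =
     \sum_(D2 : web_world n D) web_colouring_matrix D1' D2) /\
  (forall D1 : web_world n D,
     \sum_(D2 : web_world n D) web_colouring_matrix D1 D2 =
     \sum_(1 <= l < m.+1) 'X^l *+ (l`! * stirling2 m l)).
Proof.
by rewrite -sizeD; split=> [D1 D1'|D1]; rewrite ?(row_sum _ webD).
Qed.
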